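(* Let $B$ be a boolean algebra and let $X$ be its Stone space. For a necessity operator $\Box$ on $B$, define a binary relation $R_\Box$ on $X$ by $$x \mathrel{R_\Box} y \iff \Box^{-1}[x]\subseteq y \qquad (x,y\in X).$$ Then the assignment $\Box\mapsto R_\Box$ is a dual isomorphism (order-reversing bijection with order-reversing inverse) from the poset $\mathcal{NO}(B)$ of necessity operators on $B$ onto the poset $\mathcal{CR}(X)$ of continuous relations on $X$.
   Context: A necessity operator on a boolean algebra $B$ is a function $\Box\colon B\to B$ preserving finite meets (including the empty meet, so $\Box 1=1$). $\mathcal{NO}(B)$ is the set of necessity operators on $B$, ordered pointwise: $f\le g$ iff $f(a)\le g(a)$ for all $a\in B$. The Stone space $X$ of $B$ is the set of ultrafilters of $B$ with the topology generated by the sets $\sigma(a)=\{x\in X: a\in x\}$, $a\in B$. For $x\in X$, $\Box^{-1}[x]=\{a\in B : \Box a\in x\}$. A binary relation $R$ on a Stone space (compact Hausdorff zero-dimensional space) $X$ is continuous if $R[x]=\{y : x\mathrel{R}y\}$ is closed for each $x\in X$ and $R^{-1}[U]=\{x : x \mathrel{R} y \text{ for some } y\in U\}$ is clopen for each clopen $U\subseteq X$. $\mathcal{CR}(X)$ is the set of continuous relations on $X$, ordered by inclusion. *)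

(* Defs.v *)
From HB Require Import structures.
From mathcomp Require Import all_boot all_order.
From mathcomp Require Import all_classical topology.

Set Implicit Arguments.
Unset Strict Implicit.
Unset Printing Implicit Defensive.

Import Order.TTheory.
Local Open Scope classical_set_scope.
Local Open Scope order_scope.

(* Boolean algebras are [ctbDistrLatticeType]s; the one-element algebra is
   included (its Stone space is empty). *)

Section Ultrafilters.
Context {d : Order.disp_t} (B : ctbDistrLatticeType d).

Definition proper_filter (F : set B) : Prop :=
  [/\ F \top,
      forall a b, F a -> F b -> F (a `&` b),
      forall a b, a <= b -> F a -> F b
    & ~ F \bot].

Definition ultrafilter (F : set B) : Prop :=
  proper_filter F /\ forall G : set B, proper_filter G -> F `<=` G -> G = F.

Record stone : Type := Stone {
  stone_set : set B;
  stone_ultrafilter : ultrafilter stone_set }.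

HB.instance Definition _ := gen_eqMixin stone.
HB.instance Definition _ := gen_choiceMixin stone.

Definition stone_sigma (a : B) : set stone := [set x : stone | stone_set x a].

HB.instance Definition _ :=
  @isSubBaseTopological.Build stone (set stone) (range stone_sigma) id.

End Ultrafilters.

(* [f] preserves all finite meets; for [s = [::]] this is [f \top = \top].
   [B -> B] carries the pointwise order (FunOrder in mathcomp.classical). *)
Definition NO {d : Order.disp_t} (B : ctbDistrLatticeType d) : set (B -> B) :=
  [set f | forall s : seq B, f (\meet_(a <- s) a) = \meet_(a <- s) f a].
Arguments NO {d} B _.

Section ContinuousRelations.
Context {X : topologicalType}.

(* Relations are sets of pairs, so that inclusion is the order of [set _]. *)
Definition rel_image (R : set (X * X)) (x : X) : set X := [set y | R (x, y)].

Definition rel_preimage (R : set (X * X)) (U : set X) : set X :=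
  [set x | exists2 y, R (x, y) & U y].

Definition continuous_rel (R : set (X * X)) : Prop :=
  (forall x, closed (rel_image R x)) /\
  (forall U, clopen U -> clopen (rel_preimage R U)).

End ContinuousRelations.

Definition CR (X : topologicalType) : set (set (X * X)) :=
  [set R | continuous_rel R].
Arguments CR X _ : clear implicits.

Definition box_rel {d : Order.disp_t} {B : ctbDistrLatticeType d}
    (f : B -> B) : set (stone B * stone B) :=
  [set xy | f @^-1` stone_set xy.1 `<=` stone_set xy.2].

(* [f] restricts to a dual isomorphism from the subposet [A] of [P] onto the
   subposet [C] of [Q]; only the values of [g] on [C] matter, and there [g] is
   the inverse of the restriction. *)
Definition dual_isomorphism {d d' : Order.disp_t}
    {P : porderType d} {Q : porderType d'}
    (A : set P) (C : set Q) (f : P -> Q) : Prop :=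
  [/\ set_bij A C f,
      {in A &, {homo f : x y /~ x <= y}}
    & exists2 g : Q -> P,
        {in A, cancel f g} & {in C &, {homo g : x y /~ x <= y}}].

(* Main.v *)
Require Import Defs.
From mathcomp Require Import all_boot all_order finmap.
From mathcomp Require Import all_classical topology.

(** By the ultrafilter lemma, a filter of [B] is the intersection of the
    ultrafilters containing it. Applied to [box^-1[x]] this gives
    [box a \in x] iff [y] contains [a] for all [y] with [x R_box y], so that
    [R_box] determines [box], and inclusions are reversed. Conversely, every
    clopen set of [X] is some [sigma b], so a continuous relation [R] yields an
    operator through [sigma (box a) = ~ R^-1[~ sigma a]]; then [R_box[x]] is the
    closure of [R[x]], hence [R[x]] itself. *)

Import Order.Theory.
Local Open Scope classical_set_scope.
Local Open Scope order_scope.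

(** * Filters, ultrafilters and the topology of the Stone space *)

Section StoneSpace.
Context {d : Order.disp_t} {B : ctbDistrLatticeType d}.
Implicit Types (a b c : B) (F G : set B) (x y : stone B).

Definition lattice_filter F : Prop :=
  [/\ F \top,
      forall a b, F a -> F b -> F (a `&` b)
    & forall a b, a <= b -> F a -> F b].

Lemma ultrafilter_lemma {F} :
  proper_filter F -> exists x, F `<=` stone_set x.
Proof.
move=> [F1 FI Fle F0].
(* The union with [F] makes the empty chain admissible in [Zorn_bigcup]. *)
have [|A [PA Amax]] := @Zorn_bigcup B [set G | proper_filter (F `|` G)%classic].
  move=> C CP Ctot; split.
  - by left.
  - move=> a b [Fa|[G CG Ga]] [Fb|[H CH Hb]].
    + by left; exact: FI.
    + have [_ HI _ _] := CP _ CH.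
      by have [?|?] := HI a b (or_introl Fa) (or_intror Hb);
        [left | right; exists H].
    + have [_ GI _ _] := CP _ CG.
      by have [?|?] := GI a b (or_intror Ga) (or_introl Fb);
        [left | right; exists G].
    + have [K CK [Ka Kb]] : exists2 K, C K & K a /\ K b.
        by have [GH|HG] := Ctot _ _ CG CH;
          [exists H => //; split => //; exact: GH
          |exists G => //; split => //; exact: HG].
      have [_ KI _ _] := CP _ CK.
      by have [?|?] := KI a b (or_intror Ka) (or_intror Kb);
        [left | right; exists K].
  - move=> a b ab [Fa|[G CG Ga]]; first by left; exact: Fle Fa.
    have [_ _ Gle _] := CP _ CG.
    by have [?|?] := Gle a b ab (or_intror Ga); [left | right; exists G].
  - by case=> // -[G CG G0]; have [_ _ _] := CP _ CG; apply; right.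
have Aultra : ultrafilter (F `|` A)%classic.
  split=> // G PG FAG.
  have FG : (F `|` G)%classic = G by apply/setUidPr => a Fa; apply: FAG; left.
  apply/seteqP; split=> // a Ga; apply: contrapT => FAa.
  apply: (Amax G); last by rewrite /= FG.
  split=> [b Ab|GA]; first by apply: FAG; right.
  by apply: FAa; right; exact: GA.
by exists (Stone Aultra) => a Fa; left.
Qed.

Lemma stone_filter x : lattice_filter (stone_set x).
Proof. by have [[]] := stone_ultrafilter x. Qed.

Lemma stone_top x : stone_set x \top.
Proof. by have [] := stone_filter x. Qed.

Lemma stone_le {x a b} : a <= b -> stone_set x a -> stone_set x b.
Proof. by have [_ _] := stone_filter x; apply. Qed.

Lemma stone_bot x : ~ stone_set x \bot.
Proof. by have [[]] := stone_ultrafilter x. Qed.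

Lemma stone_meet x a b :
  stone_set x (a `&` b) <-> stone_set x a /\ stone_set x b.
Proof.
split=> [ab|[]]; last by have [_ + _] := stone_filter x; apply.
by split; apply: stone_le ab; rewrite ?leIl ?leIr.
Qed.

(** The set is the filter generated by [F] and the complement of [a]. If it contained [\bot], some
    [b] in [F] would be disjoint from that complement, so [b <= a] and [a] would be in [F]. *)
Lemma proper_filter_adjoinC {F a} : lattice_filter F -> ~ F a ->
  proper_filter [set c | exists2 b, F b & b `&` ~` a <= c].
Proof.
move=> [F1 FI Fle] Fa; split.
- by exists \top; rewrite ?lex1.
- move=> b c [b' Fb bb'] [c' Fc cc']; exists (b' `&` c'); first exact: FI.
  rewrite lexI (le_trans _ bb') ?(le_trans _ cc') // lexI leIr andbT.
    by rewrite (le_trans (leIl _ _)) ?leIr.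
  by rewrite (le_trans (leIl _ _)) ?leIl.
- by move=> b c bc [b' Fb le_b]; exists b' => //; exact: le_trans bc.
- case=> b Fb; rewrite lex0 disj_leC complK => ba.
  by apply: Fa; exact: Fle Fb.
Qed.

Lemma stone_compl x a : stone_set x (~` a) <-> ~ stone_set x a.
Proof.
split=> [xCa xa|xa].
  by apply: (stone_bot x); rewrite -(meetxC a); apply/stone_meet.
(* Adjoining the complement of [a] to [x] leaves a proper filter, which equals [x] by maximality. *)
have [_ xmax] := stone_ultrafilter x.
rewrite -(xmax _ (proper_filter_adjoinC (stone_filter x) xa)) => [|b xb].
  by exists \top; [exact: stone_top | rewrite meet1x].
by exists b; rewrite ?leIl.
Qed.

Lemma filter_separation {F a} : lattice_filter F ->
  (forall x, F `<=` stone_set x -> stone_set x a) -> F a.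
Proof.
move=> Ffilt Fa; apply: contrapT => NFa.
have [x Gx] := ultrafilter_lemma (proper_filter_adjoinC Ffilt NFa).
have /stone_compl[] : stone_set x (~` a).
  by have [F1 _ _] := Ffilt; apply: Gx; exists \top; rewrite ?meet1x.
by apply: Fa => b Fb; apply: Gx; exists b; rewrite ?leIl.
Qed.

Lemma stone_leP a b :
  (forall x, stone_set x a -> stone_set x b) -> a <= b.
Proof.
move=> ab; apply: (@filter_separation [set c | a <= c]); first split=> /=.
- exact: lex1.
- by move=> c e ac ae; rewrite lexI ac.
- by move=> c e ce ac; exact: le_trans ce.
- by move=> x ax; exact/ab/ax/lexx.
Qed.

Lemma stone_eqP a b :
  (forall x, stone_set x a <-> stone_set x b) -> a = b.
Proof. by move=> ab; apply/le_anti/andP; split; apply: stone_leP => x /ab. Qed.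

Lemma open_stone_sigma a : open (stone_sigma a).
Proof.
exists [set stone_sigma a]; last by rewrite bigcup_set1.
move=> _ ->; exists [fset (stone_sigma a)]%fset.
  by move=> U /fset1P ->; apply: mem_set; exists a.
apply/seteqP; split=> x /=; first by apply; exact: fset11.
by move=> ax U /fset1P ->.
Qed.

(** The subbase is in fact a base: a finite intersection of sets [stone_sigma a] is [stone_sigma] of
    the meet, built below by induction on the list of these sets. *)
Lemma open_stoneP {U : set (stone B)} {x} : open U -> U x ->
  exists2 a, stone_set x a & stone_sigma a `<=` U.
Proof.
move=> [C CD <-] [V CV Vx].
have [S SD SV] : finI_from (range (@stone_sigma d B)) id V := CD _ CV.
suff [a xa aS] : exists2 a, stone_set x a &
    forall y, stone_set y a -> forall W, W \in enum_fset S -> W y.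
  exists a => // y ya; exists V; first exact: CV.
  suff: V y by [].
  by rewrite -SV => W WS; exact: aS WS.
have {SD} : forall W, W \in enum_fset S -> W x /\ range (@stone_sigma d B) W.
  move=> W WS; split; last exact: set_mem (SD _ WS).
  by have : V x := Vx; rewrite -SV; apply.
elim: (enum_fset S) => [_|W s IH sP].
  by exists \top => //; exact: stone_top.
have [|a xa aS] := IH; first by move=> V' V's; apply: sP; rewrite inE V's orbT.
have [|Wx [b _ Wb]] := sP W; first by rewrite inE eqxx.
exists (a `&` b); first by apply/stone_meet; split=> //; move: Wx; rewrite -Wb.
move=> y /stone_meet[ya yb] V'; rewrite inE => /predU1P[->|]; last exact: aS.
by rewrite -Wb.
Qed.

Lemma stone_sigmaC a : (~` stone_sigma a)%classic = stone_sigma (~` a).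
Proof. by apply/seteqP; split=> x /= /stone_compl. Qed.

Lemma closed_stone_sigma a : closed (stone_sigma a).
Proof. by rewrite -openC stone_sigmaC; exact: open_stone_sigma. Qed.

Lemma closed_stoneP {C : set (stone B)} {x} : closed C ->
  (forall a, C `<=` stone_sigma a -> stone_set x a) -> C x.
Proof.
move=> Ccl Cx; apply: contrapT => NCx.
have [|a xa aC] := @open_stoneP (~` C)%classic x _ NCx; first by rewrite openC.
suff /stone_compl : stone_set x (~` a) by [].
by apply: Cx => y Cy; apply/stone_compl => /aC.
Qed.

(** A compactness argument carried out on filters: finitely many basic sets, each inside [U] or
    inside its complement, cover the space, and the join of those inside [U] represents [U]. *)
Lemma clopen_stoneP {U : set (stone B)} :
  clopen U -> exists a, U = stone_sigma a.
Proof.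
move=> [Uop Ucl]; pose C := (~` U)%classic.
have Cop : open C by rewrite openC.
(* [F] is the filter generated by the complements of the elements whose basic sets lie inside [U] or
   inside [C]. *)
pose F := [set c | exists a b,
  [/\ stone_sigma a `<=` U, stone_sigma b `<=` C & ~` (a `|` b) <= c]].
have Ffilt : lattice_filter F.
  split.
  - by exists \bot, \bot; split; rewrite ?lex1 // => x /stone_bot.
  - move=> c1 c2 [a1 [b1 [a1U b1C le1]]] [a2 [b2 [a2U b2C le2]]].
    exists (a1 `|` a2), (b1 `|` b2); split.
    + move=> x; apply: contraPP => NUx; rewrite /stone_sigma /=.
      apply/stone_compl; rewrite complU; apply/stone_meet.
      by split; apply/stone_compl; [move/a1U|move/a2U].
    + move=> x; apply: contraPP => NCx; rewrite /stone_sigma /=.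
      apply/stone_compl; rewrite complU; apply/stone_meet.
      by split; apply/stone_compl; [move/b1C|move/b2C].
    + by rewrite joinACA complU leI2.
  - move=> c1 c2 c12 [a [b [aU bC le1]]].
    by exists a, b; split=> //; exact: le_trans c12.
have [a [b [aU bC]]] : F \bot.
  (* An ultrafilter containing [F] would lie neither in [U] nor in [C]. *)
  apply: (filter_separation Ffilt) => x Fx; exfalso.
  have NF c : F (~` c) -> stone_set x c -> False.
    by move=> /Fx /stone_compl.
  have [Ux|Cx] := pselect (U x).
    have [c xc cU] := open_stoneP Uop Ux.
    apply: NF xc; exists c, \bot; split=> //; last by rewrite joinx0.
    by move=> y /stone_bot.
  have [c xc cC] := open_stoneP Cop Cx.
  apply: NF xc; exists \bot, c; split=> //; last by rewrite join0x.
  by move=> y /stone_bot.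
(* Now [a] and [b] join to [\top], so a point of [U] outside [stone_sigma a] would lie in
   [stone_sigma b], hence in [C]. *)
rewrite lex0 complU disj_leC complK => ba.
exists a; apply/seteqP; split=> // x Ux; apply: contrapT => /stone_compl xa.
by have /bC := stone_le ba xa.
Qed.

End StoneSpace.

(** * Necessity operators and their relations *)

Section BoxRelation.
Context {d : Order.disp_t} {B : ctbDistrLatticeType d}.
Implicit Types (a b : B) (f g : B -> B) (x y : stone B).
Implicit Types (R : set (stone B * stone B)).

Lemma NOP f :
  NO B f <-> f \top = \top /\ forall a b, f (a `&` b) = f a `&` f b.
Proof.
split=> [fNO|[f1 fI] s]; last exact: big_morph.
split=> [|a b]; first by have := fNO [::]; rewrite !big_nil.
by have := fNO [:: a; b]; rewrite !big_cons !big_nil !meetx1.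
Qed.

Lemma NO_preimage_filter {f} x :
  NO B f -> lattice_filter (f @^-1` stone_set x).
Proof.
move=> /NOP[f1 fI]; split=> [|a b xa xb|a b /meet_idPl <-] /=.
- by rewrite f1; exact: stone_top.
- by rewrite fI; apply/stone_meet.
- by rewrite fI => /stone_meet[].
Qed.

Lemma NO_stoneP {f} x a : NO B f ->
  stone_set x (f a) <-> (forall y, box_rel f (x, y) -> stone_set y a).
Proof.
move=> fNO; split=> [xa y|]; first exact.
exact: filter_separation (NO_preimage_filter x fNO).
Qed.

Lemma box_rel_le f g : NO B g ->
  (box_rel g `<=` box_rel f)%classic -> f <= g.
Proof.
move=> gNO gf; apply/lefP => a; apply: stone_leP => x xa.
by apply/(NO_stoneP x a gNO) => y /gf; exact.
Qed.

Lemma le_box_rel f g : f <= g -> (box_rel g `<=` box_rel f)%classic.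
Proof.
by move=> /lefP fg [x y] gxy a; move=> /(stone_le (fg a)); exact: gxy.
Qed.

Lemma box_rel_inj : {in NO B &, injective box_rel}.
Proof.
move=> f g /set_mem fNO /set_mem gNO fg.
by apply/le_anti/andP; split; apply: box_rel_le => //; rewrite fg.
Qed.

(** Images of points are intersections of basic closed sets; the preimage of [stone_sigma a] is
    [stone_sigma] of the possibility operator dual to [f], applied to [a]. *)
Lemma box_rel_continuous f : NO B f -> CR (stone B) (box_rel f).
Proof.
move=> fNO; split=> [x|_ /clopen_stoneP[a ->]].
  rewrite (_ : rel_image _ x =
      \bigcap_(a in f @^-1` stone_set x) stone_sigma a) //.
  by apply: closed_bigI => a _; exact: closed_stone_sigma.
rewrite (_ : rel_preimage _ _ = stone_sigma (~` f (~` a))).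
  by split; [exact: open_stone_sigma | exact: closed_stone_sigma].
apply/seteqP; split=> x /=.
  by move=> [y xy ya]; apply/stone_compl => /xy /stone_compl.
move=> /stone_compl /(NO_stoneP _ _ fNO) /existsNP[y /not_implyP[xy]].
by move=> ya; exists y => //; apply: contrapT => /stone_compl.
Qed.

Lemma box_rel_surj R :
  continuous_rel R -> exists2 f, NO B f & box_rel f = R.
Proof.
move=> [Rcl Rclopen].
have /choice[f fP] a : exists b, forall x,
    stone_set x b <-> (forall y, R (x, y) -> stone_set y a).
  have [|b Rb] := clopen_stoneP (Rclopen (stone_sigma (~` a)) _).
    by split; [exact: open_stone_sigma | exact: closed_stone_sigma].
  (* Here [b] represents the points with a successor outside [stone_sigma a]. *)
  exists (~` b) => x; rewrite stone_compl -[stone_set x b]/(stone_sigma b x) -Rb.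
  split=> [NR y xy|Ra [y /Ra ya /stone_compl]] //.
  by apply: contrapT => ya; apply: NR; exists y => //; apply/stone_compl.
exists f.
  apply/NOP; split=> [|a b]; apply: stone_eqP => x.
    by split=> _; [|apply/fP => y _]; exact: stone_top.
  rewrite stone_meet !fP; split=> [Rab|[Ra Rb] y xy].
    by split=> y /Rab /stone_meet[].
  by apply/stone_meet; split; [exact: Ra|exact: Rb].
apply/seteqP; split=> -[x y] /= => [xy|Rxy a].
  (* Any basic set [stone_sigma a] containing the closed image of [x] has [f a] in [x], hence [a] in
     [y]. *)
  by apply: closed_stoneP (Rcl x) _ => a Ra; apply: xy => /=; exact/fP.
by move=> /= /fP; exact.
Qed.

End BoxRelation.

Theorem lemma1p4 (d : Order.disp_t) (B : ctbDistrLatticeType d) :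
  dual_isomorphism (NO B) (CR (stone B)) (@box_rel d B).
Proof.
have /choice[g gP] (R : set (stone B * stone B)) : exists f,
    CR (stone B) R -> NO B f /\ box_rel f = R.
  (* The inverse must be total on sets of pairs; [id] is a default value outside [CR]. *)
  have [RCR|NR] := pselect (CR (stone B) R); last by exists id.
  by have [f fNO fR] := box_rel_surj R RCR; exists f.
split.
- split=> [f /box_rel_continuous //||R /box_rel_surj[f fNO fR]].
    exact: box_rel_inj.
  by exists f.
- by move=> f f' _ _ /le_box_rel ff'; apply/subsetPset.
- exists g => [f /set_mem fNO|R S /set_mem RCR /set_mem SCR].
    (* Both [g (box_rel f)] and [f] are necessity operators with the same relation, so injectivity
       identifies them. *)
    have [gNO gf] := gP _ (box_rel_continuous _ fNO).
    by apply: box_rel_inj; rewrite ?mem_set.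
  have [gR gRE] := gP _ RCR; have [gS gSE] := gP _ SCR.
  by move=> /subsetPset SR; apply: box_rel_le; rewrite // gRE gSE.
Qed.
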